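(* Let $r \le \min(M,N)$ be positive integers and let $\mathcal{P}=\mathcal{B}_{1,+}=\{\mathbf{x}\in\mathbb{R}^r \mid \mathbf{x}\ge\mathbf{0},\ \mathbf{1}^T\mathbf{x}\le 1\}$. Let $\mathbf{H}_g\in\mathbb{R}^{M\times r}$ have full column rank, let $\mathbf{S}_g\in\mathbb{R}^{r\times N}$ have all of its columns in $\mathcal{P}$, and set $\mathbf{Y}=\mathbf{H}_g\mathbf{S}_g$. Suppose $\mathbf{S}_g$ is a sufficiently scattered factor corresponding to $\mathcal{P}$ (as defined in the context). Consider the Det-Max optimization problem $$\max_{\mathbf{H}\in\mathbb{R}^{M\times r},\ \mathbf{S}\in\mathbb{R}^{r\times N}} \det(\mathbf{S}\mathbf{S}^T)\quad\text{subject to}\quad \mathbf{Y}=\mathbf{H}\mathbf{S},\ \ \mathbf{S}_{:,j}\in\mathcal{P}\ \ (j=1,\dots,N).$$ Then every global optimum $(\mathbf{H}_*,\mathbf{S}_* )$ of this problem satisfies $$\mathbf{H}_*=\mathbf{H}_g\boldsymbol{\Pi}^T,\qquad \mathbf{S}_*=\boldsymbol{\Pi}\mathbf{S}_g,$$ for some permutation matrix $\boldsymbol{\Pi}\in\mathbb{R}^{r\times r}$.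
   Context: $\mathbf{1}$ and $\mathbf{0}$ denote the all-ones and all-zeros vectors; $\mathbf{x}\ge\mathbf{0}$ is componentwise. $\mathbf{S}_{:,j}$ denotes the $j$-th column of $\mathbf{S}$; $\mathrm{conv}(\mathbf{S})$ is the convex hull of the columns of $\mathbf{S}$. For a convex polytope $\mathcal{P}\subset\mathbb{R}^r$ with nonempty interior, $\mathcal{E}_\mathcal{P}$ denotes its maximum volume inscribed ellipsoid (MVIE), i.e. the (unique) ellipsoid of maximal volume contained in $\mathcal{P}$, written $\mathcal{E}_\mathcal{P}=\{\mathbf{C}_\mathcal{P}\mathbf{u}+\mathbf{g}_\mathcal{P}\mid \|\mathbf{u}\|_2\le 1\}$ with $\mathbf{C}_\mathcal{P}\succeq 0$ and center $\mathbf{g}_\mathcal{P}$. For a set $C\subset\mathbb{R}^r$ and point $\mathbf{d}$, the polar of $C$ with respect to $\mathbf{d}$ is $C^{*,\mathbf{d}}=\{\mathbf{x}\in\mathbb{R}^r\mid \langle\mathbf{x},\mathbf{y}-\mathbf{d}\rangle\le 1\ \forall \mathbf{y}\in C\}$. $\mathrm{bd}(\cdot)$ denotes boundary and $\mathrm{ext}(\cdot)$ the set of extreme points (vertices). A matrix $\mathbf{S}\in\mathbb{R}^{r\times N}$ is called a sufficiently scattered factor corresponding to $\mathcal{P}$ if (i) $\mathcal{P}\supseteq\mathrm{conv}(\mathbf{S})\supset\mathcal{E}_\mathcal{P}$, and (ii) $\mathrm{conv}(\mathbf{S})^{*,\mathbf{g}_\mathcal{P}}\cap\mathrm{bd}(\mathcal{E}_\mathcal{P}^{*,\mathbf{g}_\mathcal{P}})=\mathrm{ext}(\mathcal{P}^{*,\mathbf{g}_\mathcal{P}})$.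 *)

(* Defs.v *)
From HB Require Import structures.
From mathcomp Require Import all_boot all_order all_algebra all_fingroup.
From mathcomp Require Import reals.
Set Implicit Arguments. Unset Strict Implicit. Unset Printing Implicit Defensive.
Import Order.TTheory GRing.Theory Num.Theory.
Local Open Scope ring_scope.

Section Defs.
Variable R : realType.
Variable r : nat.

Definition vset := 'cV[R]_r -> Prop.

Definition dotv (x y : 'cV[R]_r) : R := \sum_(i < r) x i 0 * y i 0.

Definition B1plus : vset :=
  fun x => (forall i, 0 <= x i 0) /\ \sum_(i < r) x i 0 <= 1.

Definition subset (A B : vset) := forall x, A x -> B x.

Definition conv_cols N (S : 'M[R]_(r, N)) : vset :=
  fun x => exists lam : 'cV[R]_N,
    (forall j, 0 <= lam j 0) /\ \sum_(j < N) lam j 0 = 1 /\ x = S *m lam.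

Definition psd (C : 'M[R]_r) :=
  C^T = C /\ forall u : 'cV[R]_r, 0 <= dotv u (C *m u).

Definition ellipsoid (C : 'M[R]_r) (g : 'cV[R]_r) : vset :=
  fun x => exists u, dotv u u <= 1 /\ x = C *m u + g.

(* (C, g) describes a maximum volume inscribed ellipsoid of P
   (volume of the ellipsoid is proportional to det C for C psd) *)
Definition is_MVIE (P : vset) (C : 'M[R]_r) (g : 'cV[R]_r) :=
  psd C /\ subset (ellipsoid C g) P /\
  forall C' g', psd C' -> subset (ellipsoid C' g') P -> \det C' <= \det C.

Definition polar (A : vset) (d : 'cV[R]_r) : vset :=
  fun x => forall y, A y -> dotv x (y - d) <= 1.

Definition boundary (A : vset) : vset :=
  fun x => forall e : R, 0 < e ->
    (exists y, dotv (y - x) (y - x) < e ^+ 2 /\ A y) /\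
    (exists z, dotv (z - x) (z - x) < e ^+ 2 /\ ~ A z).

Definition extreme (A : vset) : vset :=
  fun x => A x /\ forall y z (t : R), A y -> A z -> 0 < t -> t < 1 ->
    x = t *: y + (1 - t) *: z -> y = z.

Definition set_eq (A B : vset) := forall x, A x <-> B x.

Definition inter (A B : vset) : vset := fun x => A x /\ B x.

Definition suff_scattered (P : vset) N (S : 'M[R]_(r, N)) :=
  exists (C : 'M[R]_r) (g : 'cV[R]_r), is_MVIE P C g /\
    (subset (conv_cols S) P /\ subset (ellipsoid C g) (conv_cols S)) /\
    set_eq (inter (polar (conv_cols S) g) (boundary (polar (ellipsoid C g) g)))
           (extreme (polar P g)).

Definition detmax_feasible M N (Y : 'M[R]_(M, N)) (P : vset)
  (H : 'M[R]_(M, r)) (S : 'M[R]_(r, N)) :=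
  Y = H *m S /\ forall j : 'I_N, P (col j S).

Definition detmax_opt M N (Y : 'M[R]_(M, N)) (P : vset)
  (H : 'M[R]_(M, r)) (S : 'M[R]_(r, N)) :=
  detmax_feasible Y P H S /\
  forall H' S', detmax_feasible Y P H' S' -> \det (S' *m S'^T) <= \det (S *m S^T).

End Defs.

(* Main.v *)
Require Import Defs.
From HB Require Import structures.
From mathcomp Require Import all_boot all_order all_algebra all_fingroup.
From mathcomp Require Import reals.
From mathcomp Require Import ring lra.
Set Implicit Arguments. Unset Strict Implicit. Unset Printing Implicit Defensive.
Import Order.TTheory GRing.Theory Num.Theory.
Local Open Scope ring_scope.

(* An ellipsoid [B u + h] lies in the simplex iff its rows satisfy [|b_i| <= h_i]
   and [|sum_i b_i| <= h_0 := 1 - sum_i h_i].  With [K = diag (1/h_i) + J/h_0]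
   one has [det K = 1 / (h_0 h_1 ... h_r)] and [tr (B^T K B) <= sum_(i >= 0) h_i = 1],
   so Hadamard's inequality and two uses of AM-GM give
   [det B ^ 2 <= r^-r (h_0 ... h_r) <= r^-r (r+1)^-(r+1)], with equality only for
   [h_i = 1/(r+1)] and one specific [B B^T].  No normalisation of [B] is needed.
   An optimal [Ss] is [A Sg] with [det A ^ 2 >= 1], and [A] maps the maximal
   ellipsoid into the simplex, so [A] preserves its center and its Gram matrix.
   Then [A^T] maps each vertex [-(r+1) e_i] of the polar of the simplex into
   [polar (conv Sg)] and onto the boundary of the polar ellipsoid; scatteredness
   makes the image a vertex again, so the rows of [A] are unit vectors. *)

(** * Inner product of column vectors *)

Lemma dotvE (R : realType) n (x y : 'cV[R]_n) : dotv x y = (x^T *m y) 0 0.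
Proof. by rewrite mxE; apply: eq_bigr => i _; rewrite mxE. Qed.

Lemma dotvC (R : realType) n (x y : 'cV[R]_n) : dotv x y = dotv y x.
Proof. by apply: eq_bigr => i _; rewrite mulrC. Qed.

Lemma dotvDr (R : realType) n (x y z : 'cV[R]_n) :
  dotv x (y + z) = dotv x y + dotv x z.
Proof. by rewrite !dotvE mulmxDr mxE. Qed.

Lemma dotvZr (R : realType) n a (x y : 'cV[R]_n) : dotv x (a *: y) = a * dotv x y.
Proof. by rewrite !dotvE -scalemxAr mxE. Qed.

Lemma dotvNr (R : realType) n (x y : 'cV[R]_n) : dotv x (- y) = - dotv x y.
Proof. by rewrite !dotvE mulmxN mxE. Qed.

Lemma dotvDl (R : realType) n (x y z : 'cV[R]_n) :
  dotv (y + z) x = dotv y x + dotv z x.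
Proof. by rewrite dotvC dotvDr !(dotvC x). Qed.

Lemma dotvZl (R : realType) n a (x y : 'cV[R]_n) : dotv (a *: x) y = a * dotv x y.
Proof. by rewrite dotvC dotvZr dotvC. Qed.

Lemma dotvNl (R : realType) n (x y : 'cV[R]_n) : dotv (- x) y = - dotv x y.
Proof. by rewrite dotvC dotvNr dotvC. Qed.

Lemma dotv0r (R : realType) n (x : 'cV[R]_n) : dotv x 0 = 0.
Proof. by rewrite dotvE mulmx0 mxE. Qed.

Lemma dotv0l (R : realType) n (x : 'cV[R]_n) : dotv 0 x = 0.
Proof. by rewrite dotvC dotv0r. Qed.

Lemma dotv_mulmx (R : realType) m n (x : 'cV[R]_m) (A : 'M[R]_(m, n)) y :
  dotv x (A *m y) = dotv (A^T *m x) y.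
Proof. by rewrite !dotvE trmx_mul trmxK mulmxA. Qed.

Lemma dotv_delta (R : realType) n (x : 'cV[R]_n) i : dotv (delta_mx i 0) x = x i 0.
Proof.
rewrite /dotv (bigD1 i) //= big1 ?addr0 => [|j /negPf ji].
  by rewrite mxE !eqxx mul1r.
by rewrite mxE ji mul0r.
Qed.

Lemma dotv_const (R : realType) n (x : 'cV[R]_n) a :
  dotv (const_mx a) x = a * \sum_i x i 0.
Proof. by rewrite mulr_sumr; apply: eq_bigr => i _; rewrite mxE. Qed.

Lemma dotv_col_mx (R : realType) m n (a c : 'cV[R]_m) (b d : 'cV[R]_n) :
  dotv (col_mx a b) (col_mx c d) = dotv a c + dotv b d.
Proof. by rewrite !dotvE tr_col_mx mul_row_col mxE. Qed.

Lemma dotvv_ge0 (R : realType) n (x : 'cV[R]_n) : 0 <= dotv x x.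
Proof. by apply: sumr_ge0 => i _; rewrite -expr2 sqr_ge0. Qed.

Lemma dotvv_eq0 (R : realType) n (x : 'cV[R]_n) : (dotv x x == 0) = (x == 0).
Proof.
apply/eqP/eqP => [x0|->]; last exact: dotv0l.
apply/matrixP => i j; rewrite ord1 mxE; apply/eqP; rewrite -sqrf_eq0 expr2.
apply/eqP; apply: (psumr_eq0P _ x0) => // k _.
by rewrite -expr2 sqr_ge0.
Qed.

Lemma dotvv_gt0 (R : realType) n (x : 'cV[R]_n) : (0 < dotv x x) = (x != 0).
Proof. by rewrite lt0r dotvv_ge0 andbT dotvv_eq0. Qed.

(** Cauchy-Schwarz with its equality case [u = q / |q|]. Working with squares keeps norms out of the
    statement; the sign condition on [c] comes from [u = 0]. *)
Lemma dotv_le_ballP (R : realType) n (q : 'cV[R]_n) (c : R) :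
  (forall u, dotv u u <= 1 -> dotv q u <= c) <-> 0 <= c /\ dotv q q <= c ^+ 2.
Proof.
split=> [qc|[c0 qc] u u1].
  have c0 : 0 <= c by have := qc 0; rewrite !dotv0r; apply; exact: ler01.
  split=> //; have [->|q0] := eqVneq q 0; first by rewrite dotv0r exprn_ge0.
  have qq := dotvv_ge0 q; set s := Num.sqrt (dotv q q).
  have s0 : 0 < s by rewrite sqrtr_gt0 dotvv_gt0.
  have s2 : dotv q q = s * s by rewrite -expr2 sqr_sqrtr.
  have := qc (s^-1 *: q); rewrite dotvZl !dotvZr s2 !mulKf ?gt_eqF //.
  rewrite mulVf ?gt_eqF // -expr2 => /(_ (lexx _)) sc.
  by rewrite ler_pXn2r ?nnegrE // ltW.
have := dotvv_ge0 (q - c *: u).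
rewrite dotvDl !dotvDr !dotvNl !dotvNr !dotvZl !dotvZr (dotvC u q) => qcu.
(* The expanded square controls only [c * dotv q u], so [c = 0] is treated apart: there [q] itself
   vanishes. *)
have [c00|cn0] := eqVneq c 0.
  move: qc; rewrite c00 expr0n /= => qq; have : q = 0.
    by apply/eqP; rewrite -dotvv_eq0 eq_le qq dotvv_ge0.
  by move->; rewrite dotv0l.
have cp : 0 < c by rewrite lt0r cn0.
have : c ^+ 2 * dotv u u <= c ^+ 2 by rewrite ler_piMr // exprn_ge0.
move=> cu; rewrite -(ler_pM2l cp); nra.
Qed.

(** * Determinants by Schur complements *)

Lemma det_Schur_ul (R : comUnitRingType) m n (A : 'M[R]_m) (B : 'M_(m, n)) C (D : 'M_n) :
  A \in unitmx -> \det (block_mx A B C D) = \det A * \det (D - C *m invmx A *m B).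
Proof.
move=> uA; have -> : block_mx A B C D =
    block_mx 1%:M 0 (C *m invmx A) 1%:M *m block_mx A B 0 (D - C *m invmx A *m B).
  rewrite mulmx_block !mul1mx !mul0mx !addr0.
  by rewrite mulmxKV // addrC subrK.
by rewrite det_mulmx det_lblock det_ublock !det1 !mul1r.
Qed.

Lemma det_Schur_dr (R : comUnitRingType) m n (A : 'M[R]_m) (B : 'M_(m, n)) C (D : 'M_n) :
  D \in unitmx -> \det (block_mx A B C D) = \det D * \det (A - B *m invmx D *m C).
Proof.
move=> uD; have -> : block_mx A B C D =
    block_mx 1%:M (B *m invmx D) 0 1%:M *m block_mx (A - B *m invmx D *m C) 0 C D.
  rewrite mulmx_block !mul1mx !mul0mx !add0r.
  by rewrite mulmxKV // subrK.
by rewrite det_mulmx det_ublock det_lblock !det1 !mul1r mulrC.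
Qed.

(** The matrix determinant lemma: the block matrix with diagonal blocks [1] and [diag_mx d],
    bordered by the row [- w] and the column [1], is expanded with either diagonal block as
    pivot. *)
Lemma det_diag_add_const (R : fieldType) n (d : 'rV[R]_n) (w : R) :
  (forall i, d 0 i != 0) ->
  \det (diag_mx d + const_mx w) = (\prod_i d 0 i) * (1 + w * \sum_i (d 0 i)^-1).
Proof.
move=> d0; have dV : diag_mx d *m diag_mx (\row_i (d 0 i)^-1) = 1%:M.
  rewrite mulmx_diag; apply/matrixP => i j; rewrite !mxE.
  by case: eqP => [->|]; rewrite ?mulfV ?mulr0n.
have [uD _] := mulmx1_unit dV.
have iD : invmx (diag_mx d) = diag_mx (\row_i (d 0 i)^-1).
  by rewrite -[LHS]mulmx1 -dV mulmxA mulVmx // mul1mx.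
have := det_Schur_dr 1%:M (- const_mx w : 'rV_n) (const_mx 1) uD.
rewrite det_Schur_ul ?unitmx1 // det1 mul1r invmx1 mulmx1 det_diag iD det_mx11.
have -> : diag_mx d - (const_mx 1 : 'cV[R]_n) *m (- const_mx w : 'rV[R]_n) = diag_mx d + const_mx w.
  rewrite mulmxN opprK; congr (_ + _); apply/matrixP => i j.
  by rewrite !mxE big_ord1 !mxE mul1r.
move=> ->; congr (_ * _); rewrite !mulNmx opprK mxE; congr (_ + _).
  by rewrite mxE.
rewrite mxE mulr_sumr; apply: eq_bigr => i _.
by rewrite mul_mx_diag !mxE mulr1.
Qed.

(** * Positive definite matrices and Hadamard's inequality *)

Definition posdef (R : realType) n (M : 'M[R]_n) :=
  M^T = M /\ forall u : 'cV[R]_n, u != 0 -> 0 < dotv u (M *m u).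

(** The vector [(1, 0)] gives the sign of the pivot. For fixed [w] the form at [(t, w)] is minimal
    at [t = - a^-1 * dotv v w], where its value is the form of the Schur complement. *)
Lemma posdef_Schur (R : realType) n (a : R) (v : 'cV[R]_n) (N : 'M[R]_n) :
  posdef (block_mx a%:M v^T v N : 'M_(1 + n)) ->
  0 < a /\ posdef (N - a^-1 *: (v *m v^T)).
Proof.
have dot1 (s t : R) : dotv (s%:M : 'cV_1) t%:M = s * t.
  by rewrite /dotv big_ord1 !mxE !mulr1n.
have quad t w : dotv (col_mx t%:M w)
    ((block_mx a%:M v^T v N : 'M_(1 + n)) *m col_mx t%:M w) =
    a * t ^+ 2 + t * dotv v w *+ 2 + dotv w (N *m w).
  rewrite mul_block_col dotv_col_mx !dotvDr -scalar_mxM mul_mx_scalar dot1.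
  rewrite (_ : v^T *m w = (dotv v w)%:M) ?dot1 ?dotvZr ?(dotvC w v); first by ring.
  by rewrite [LHS]mx11_scalar dotvE.
move=> [sM pM]; have a0 : 0 < a.
  have := pM (col_mx 1%:M 0); rewrite quad dotv0r dotv0l col_mx_eq0 negb_and.
  rewrite -scalemx1 scale1r oner_eq0 /=  => /(_ isT); lra.
split=> //; split.
  move: sM; rewrite (tr_block_mx a%:M v^T v N) => /eq_block_mx[_ _ _ sN].
  by rewrite linearB linearZ /= trmx_mul trmxK sN.
move=> w w0; have := pM (col_mx (- a^-1 * dotv v w)%:M w).
rewrite quad col_mx_eq0 negb_and w0 orbT => /(_ isT).
rewrite mulmxBl dotvDr dotvNr -scalemxAl dotvZr -mulmxA [dotv w (v *m _)]dotv_mulmx.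
rewrite (_ : dotv (v^T *m w) (v^T *m w) = dotv v w ^+ 2); last first.
  by rewrite [v^T *m w]mx11_scalar -dotvE dot1.
set b := dotv v w; set c := dotv w _.
suff -> : a * (- a^-1 * b) ^+ 2 + - a^-1 * b * b *+ 2 + c = c - a^-1 * b ^+ 2 by [].
by field; rewrite gt_eqF.
Qed.

Lemma posdef_diag_gt0 (R : realType) n (M : 'M[R]_n) i : posdef M -> 0 < M i i.
Proof.
move=> [_ /(_ (delta_mx i 0))]; rewrite -colE dotv_delta mxE; apply.
by apply/eqP => /matrixP/(_ i 0)/eqP; rewrite !mxE !eqxx oner_eq0.
Qed.

(** Induction through the Schur complement [S] of the first entry: the determinant is [a * \det S],
    and [S i i] is [N i i] minus [a^-1 * v i 0 ^+ 2]. Equality thus forces [v = 0], and then a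
    diagonal [S = N]. *)
Lemma hadamard_posdef (R : realType) n (M : 'M[R]_n) : posdef M ->
  0 < \det M /\ \det M <= \prod_i M i i ?= iff is_diag_mx M.
Proof.
elim: n M => [|n IHn].
  move=> M _; rewrite det_mx00 big_ord0 ltr01; split=> //; split=> //; rewrite eqxx.
  by apply/esym/is_diag_mxP => -[].
rewrite -[n.+1]/(1 + n)%N => M pM; have sM := pM.1; move: pM sM.
rewrite -[M]submxK.
rewrite [ulsubmx _]mx11_scalar; set a := ulsubmx _ 0 0.
set v := dlsubmx M; set N := drsubmx M.
move=> pM; rewrite tr_block_mx => /eq_block_mx[_ _ vE _]; move: pM.
rewrite -[ursubmx _]trmxK vE => pM; have [a0 pS] := posdef_Schur pM.
set S := N - _ in pS; have [dS [dS1 dS2]] := IHn _ pS.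
have SE i : S i i = N i i - a^-1 * v i 0 ^+ 2.
  by rewrite !mxE big_ord1 !mxE -expr2.
have SN i : S i i <= N i i.
  by rewrite SE gerBl mulr_ge0 ?sqr_ge0 // invr_ge0 ltW.
have S0 i : 0 < S i i by exact: posdef_diag_gt0.
have dE : \det (block_mx a%:M v^T v N) = a * \det S.
  rewrite det_Schur_ul ?unitmxE ?det_scalar1 ?unitfE ?gt_eqF //.
  by rewrite invmx_scalar mul_mx_scalar -scalemxAl.
have -> : \prod_i (block_mx a%:M v^T v N : 'M_(1 + n)) i i = a * \prod_i N i i.
  rewrite big_split_ord big_ord1 block_mxEul mxE mulr1n; congr (_ * _).
  by apply: eq_bigr => i _; rewrite block_mxEdr.
have PSN : \prod_i S i i <= \prod_i N i i.
  by apply: ler_prod => i _; rewrite SN ltW.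
rewrite dE pmulr_rgt0 //; split=> //; split.
  by rewrite ler_pM2l // (le_trans dS1).
rewrite is_diag_block_mx // -trmx_eq0 trmxK.
have [v0|v0] /= := eqVneq v 0; last first.
  have /existsP[i vi] : [exists i, v i 0 != 0].
    apply: contraT; rewrite negb_exists => /forallP v00.
    case/eqP: v0; apply/matrixP => i j; rewrite ord1 [RHS]mxE.
    by apply/eqP; have := v00 i; rewrite negbK.
  apply/negbTE; rewrite lt_eqF // ltr_pM2l //.
  apply: (le_lt_trans dS1); rewrite (bigD1 i) //= [ltRHS](bigD1 i) //=.
  apply: (@lt_le_trans _ _ (N i i * \prod_(j < n | j != i) S j j)).
    rewrite ltr_pM2r ?prodr_gt0 // SE gtrBl pmulr_rgt0 ?invr_gt0 //.
    by rewrite exprn_even_gt0.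
  rewrite ler_pM2l; last exact: lt_le_trans (S0 i) (SN i).
  by apply: ler_prod => j _; rewrite SN ltW.
have SNE : S = N by rewrite /S v0 mul0mx scaler0 subr0.
rewrite SNE in dS2 *; rewrite (inj_eq (mulfI (lt0r_neq0 a0))) dS2.
by rewrite (_ : is_diag_mx a%:M) //; apply/is_diag_mxP => i j; rewrite !ord1.
Qed.

(** * AM-GM, and the algebra of diagonal plus constant matrices *)

Lemma AGM_ord (R : realType) n (E : 'I_n -> R) : (forall i, 0 <= E i) ->
  \prod_i E i <= ((\sum_i E i) / n%:R) ^+ n ?= iff [forall i, forall j, E i == E j].
Proof.
move=> E0; have := @leif_AGM R 'I_n predT E (fun i _ => E0 i).
by rewrite card_ord.
Qed.

Lemma eq_mean (R : realType) n (E : 'I_n -> R) :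
  [forall i, forall j, E i == E j] -> forall i, E i = (\sum_j E j) / n%:R.
Proof.
case: n E => [|n] E /'forall_'forall_eqP EE i; first by case: i.
rewrite (eq_bigr (fun=> E i)) // sumr_const card_ord -[E i *+ _]mulr_natr mulfK //.
by rewrite pnatr_eq0.
Qed.

Lemma trmx_scalar_const (R : realType) n (a b : R) :
  (a%:M + const_mx b : 'M_n)^T = a%:M + const_mx b.
Proof. by rewrite linearD /= tr_scalar_mx trmx_const. Qed.

Lemma mulmx_scalar_const (R : realType) n (a b c d : R) :
  (a%:M + const_mx b) *m (c%:M + const_mx d) =
  (a * c)%:M + const_mx (a * d + b * c + n%:R * (b * d)) :> 'M_n.
Proof.
rewrite mulmxDl !mulmxDr -scalar_mxM mul_scalar_mx mul_mx_scalar -addrA.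
congr (_ + _); apply/matrixP => i j; rewrite !mxE.
rewrite (eq_bigr (fun=> b * d)) => [|k _]; last by rewrite !mxE.
by rewrite sumr_const card_ord -mulr_natl; ring.
Qed.

Lemma dotv_scalar_const (R : realType) n (a b : R) (u : 'cV[R]_n) :
  dotv u ((a%:M + const_mx b) *m u) = a * dotv u u + b * (\sum_i u i 0) ^+ 2.
Proof.
rewrite mulmxDl dotvDr mul_scalar_mx dotvZr; congr (_ + _).
rewrite (_ : const_mx b *m u = const_mx (b * \sum_i u i 0)).
  by rewrite dotvC dotv_const -mulrA -expr2.
apply/matrixP => i j; rewrite ord1 !mxE mulr_sumr.
by apply: eq_bigr => k _; rewrite mxE.
Qed.

Lemma posdef_congruence (R : realType) n (K B : 'M[R]_n) :
  B \in unitmx -> posdef K -> posdef (B^T *m K *m B).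
Proof.
move=> uB [sK pK]; split=> [|u u0]; first by rewrite !trmx_mul trmxK sK mulmxA.
rewrite -!mulmxA dotv_mulmx trmxK; apply: pK.
by apply: contraNneq u0 => Bu; rewrite -(mulKmx uB u) Bu mulmx0.
Qed.

Lemma posdef_diag_add_const (R : realType) n (d : 'rV[R]_n) (w : R) :
  (forall i, 0 < d 0 i) -> 0 <= w -> posdef (diag_mx d + const_mx w).
Proof.
move=> d0 w0; split=> [|u]; first by rewrite linearD /= tr_diag_mx trmx_const.
have -> : dotv u ((diag_mx d + const_mx w) *m u) =
    \sum_i d 0 i * u i 0 ^+ 2 + w * (\sum_i u i 0) ^+ 2.
  have := dotv_scalar_const 0 w u; rewrite mul0r add0r raddf0 add0r => <-.
  rewrite mulmxDl dotvDr; congr (_ + _); apply: eq_bigr => i _.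
  by rewrite mul_diag_mx mxE; ring.
have du i : 0 <= d 0 i * u i 0 ^+ 2 by rewrite mulr_ge0 ?sqr_ge0 // ltW.
move=> u0; apply: ltr_wpDr; first by rewrite mulr_ge0 ?sqr_ge0.
rewrite lt0r sumr_ge0 // andbT; apply: contraNneq u0 => /psumr_eq0P du0.
apply/eqP/matrixP => i j; rewrite ord1 mxE; apply/eqP; rewrite -sqrf_eq0.
by have /eqP := du0 (fun k _ => du k) i isT; rewrite mulf_eq0 (gt_eqF (d0 i)).
Qed.

(** * The maximum volume ellipsoid of the simplex *)

(** Each of the [r.+1] facet inequalities, read along the ellipsoid, bounds a linear form on the
    unit ball, so [dotv_le_ballP] applies to it. *)
Lemma ellipsoid_sub_B1plusP (R : realType) r (B : 'M[R]_r) (h : 'cV[R]_r) :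
  Defs.subset (ellipsoid B h) (@B1plus R r) <->
  (forall i, 0 <= h i 0 /\ (B *m B^T) i i <= h i 0 ^+ 2) /\
  (0 <= 1 - \sum_i h i 0 /\
   dotv (const_mx 1) (B *m B^T *m const_mx 1) <= (1 - \sum_i h i 0) ^+ 2).
Proof.
have ballE i : (forall u, dotv u u <= 1 -> 0 <= (B *m u + h) i 0) <->
    0 <= h i 0 /\ (B *m B^T) i i <= h i 0 ^+ 2.
  rewrite -(_ : dotv (- (B^T *m delta_mx i 0)) (- (B^T *m delta_mx i 0)) =
               (B *m B^T) i i) -?dotv_le_ballP; last first.
    by rewrite dotvNl dotvNr opprK -dotv_mulmx dotv_delta mulmxA -colE mxE.
  split=> H u /H; rewrite dotvNl -dotv_mulmx dotv_delta [(B *m u + h) i 0]mxE => ?; lra.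
have sumE : (forall u, dotv u u <= 1 -> \sum_i (B *m u + h) i 0 <= 1) <->
    0 <= 1 - \sum_i h i 0 /\
   dotv (const_mx 1) (B *m B^T *m const_mx 1) <= (1 - \sum_i h i 0) ^+ 2.
  rewrite -mulmxA dotv_mulmx -dotv_le_ballP.
  have sE u : \sum_i (B *m u + h) i 0 = dotv (B^T *m const_mx 1) u + \sum_i h i 0.
    rewrite -dotv_mulmx dotv_const mul1r -big_split.
    by apply: eq_bigr => i _; rewrite mxE.
  by split=> H u /H; rewrite sE => ?; lra.
split=> [sub|[H1 H2] x [u [u1 ->]]].
  split=> [i|]; [apply/ballE => u u1|apply/sumE => u u1].
    by case: (sub (B *m u + h)); first by exists u.
  by case: (sub (B *m u + h)); first by exists u.
by split=> [i|]; [apply: (ballE i).2|apply: sumE.2].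
Qed.

(** The centroid of the [r.+1] vertices of the simplex. *)
Definition mvie_center (R : realType) r : 'cV[R]_r := const_mx r.+1%:R^-1.

(** The inverse of [r K], where [K = (r+1)(I + J)] is the matrix in the proof of [mvie_unique] at
    the optimal [h]. *)
Definition mvie_gram (R : realType) r : 'M[R]_r :=
  let c := (r%:R * r.+1%:R)^-1 in c%:M + const_mx (- (c / r.+1%:R)).

(** The determinant of [mvie_gram]. *)
Definition mvie_det2 (R : realType) r : R := r%:R^-1 ^+ r * r.+1%:R^-1 ^+ r.+1.

(** The equality case of the determinant bound. As [B] is any square matrix, this serves both [C]
    and the image [A *m C]; the conclusion concerns [B *m B^T] because an ellipsoid fixes [B] only
    up to an orthogonal factor on the right. *)
Lemma mvie_unique (R : realType) r (B : 'M[R]_r) (h : 'cV[R]_r) : (0 < r)%N ->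
  Defs.subset (ellipsoid B h) (@B1plus R r) -> mvie_det2 R r <= \det B ^+ 2 ->
  h = mvie_center R r /\ B *m B^T = mvie_gram R r.
Proof.
move=> r0 /ellipsoid_sub_B1plusP[hB [h0 hs]] kB.
have r0R : 0 < r%:R :> R by rewrite ltr0n.
have r1R : 0 < r.+1%:R :> R by rewrite ltr0n.
have r10 : 1 + r%:R != 0 :> R by rewrite addrC natr1 gt_eqF.
have uB : B \in unitmx.
  rewrite unitmxE unitfE -sqrf_eq0 gt_eqF // (lt_le_trans _ kB) //.
  by rewrite mulr_gt0 // exprn_gt0 // invr_gt0.
have pG : posdef (B *m B^T).
  rewrite -[B in B *m _]trmxK -[_^T^T]mulmx1; apply: posdef_congruence.
    by rewrite unitmx_tr.
  by split=> [|u]; rewrite ?trmx1 ?mul1mx ?dotvv_gt0.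
have hp i : 0 < h i 0.
  have [hi0 hi] := hB i; rewrite lt0r hi0 andbT -sqrf_eq0 gt_eqF //.
  exact: lt_le_trans (posdef_diag_gt0 i pG) hi.
move: h0 hs; set h0 := 1 - _ => h0_ge0 hs.
have h0p : 0 < h0.
  rewrite lt0r h0_ge0 andbT -sqrf_eq0 gt_eqF // (lt_le_trans _ hs) //.
  apply: pG.2; apply/eqP => /matrixP/(_ (Ordinal r0) 0)/eqP.
  by rewrite !mxE oner_eq0.
pose K : 'M[R]_r := diag_mx (\row_i (h i 0)^-1) + const_mx h0^-1.
have pK : posdef K.
  apply: posdef_diag_add_const => [i|]; last by rewrite invr_ge0.
  by rewrite mxE invr_gt0.
pose H := h0 * \prod_i h i 0.
have H0 : 0 < H by rewrite mulr_gt0 // prodr_gt0.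
have dK : \det K = H^-1.
  rewrite det_diag_add_const => [|i]; last by rewrite mxE invr_eq0 gt_eqF.
  rewrite (eq_bigr (fun i => (h i 0)^-1)) => [|i _]; last by rewrite mxE.
  rewrite prodfV [X in _ * X = _](_ : _ = h0^-1) ?invfM 1?mulrC //.
  rewrite (eq_bigr (fun i => h i 0)) => [|i _]; last by rewrite mxE invrK.
  rewrite (_ : \sum_i h i 0 = 1 - h0); last by rewrite /h0; ring.
  by field; rewrite gt_eqF.
(* [M] has the trace and determinant of [K *m (B *m B^T)], but it is also symmetric, so Hadamard's
   inequality applies. *)
pose M := B^T *m K *m B; have pM : posdef M by exact: posdef_congruence.
have dM : \det M * H = \det B ^+ 2.
  by rewrite !det_mulmx det_tr dK; field; rewrite gt_eqF.
have trM : \sum_i M i i <= 1.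
  rewrite -[\sum_i _]/(\tr M) /M -mulmxA mxtrace_mulC -mulmxA mulmxDl mxtraceD.
  rewrite (_ : 1 = \sum_i h i 0 + h0); last by rewrite /h0; ring.
  (* The diagonal part of [K] contributes at most [h i 0] for each [i], the constant part at most
     [h0]. *)
  apply: lerD.
    apply: ler_sum => i _; rewrite mul_diag_mx !mxE.
    have [_] := hB i; rewrite mxE => hi.
    by rewrite mulrC ler_pdivrMr // -expr2.
  rewrite (_ : \tr _ = h0^-1 * dotv (const_mx 1) (B *m B^T *m const_mx 1)).
    by rewrite mulrC ler_pdivrMr // -expr2.
  move: (B *m B^T) => G; rewrite dotv_const mul1r mulr_sumr /mxtrace.
  under eq_bigr do rewrite mxE.
  rewrite exchange_big; apply: eq_bigr => i _; rewrite mxE mulr_sumr.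
  by apply: eq_bigr => j _; rewrite !mxE mulr1.
have [dM0 hadM] := hadamard_posdef pM.
have AM := AGM_ord (fun i => ltW (posdef_diag_gt0 i pM)).
(* [E] puts the slack [h0] in front of the entries of [h]: one AM-GM over [r.+1] terms of sum 1
   bounds [H]. *)
pose E (i : 'I_r.+1) := if unlift ord0 i is Some j then h j 0 else h0.
have EH : \prod_i E i = H.
  rewrite big_ord_recl /E unlift_none; congr (_ * _).
  by apply: eq_bigr => i _; rewrite liftK.
have E1 : \sum_i E i = 1.
  rewrite big_ord_recl /E unlift_none /=.
  rewrite (eq_bigr (fun i => h i 0)) => [|i _]; last by rewrite liftK.
  by rewrite /h0; ring.
have AE : H <= r.+1%:R^-1 ^+ r.+1 ?= iff [forall i, forall j, E i == E j].
  have := @AGM_ord R r.+1 E; rewrite EH E1 mul1r; apply=> i.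
  by rewrite /E; case: unlift => [j|]; apply: ltW.
have T0 : 0 <= \sum_i M i i by apply: sumr_ge0 => i _; apply/ltW/posdef_diag_gt0.
have TM : ((\sum_i M i i) / r%:R) ^+ r <= r%:R^-1 ^+ r.
  apply: lerXn2r; rewrite ?nnegrE ?divr_ge0 ?invr_ge0 ?(ltW r0R) //.
  by rewrite ler_piMl // invr_ge0 ltW.
move: kB; rewrite /mvie_det2 -dM.
set c := r%:R^-1 ^+ r in TM *; set d := r.+1%:R^-1 ^+ r.+1 in AE * => kB.
have c0 : 0 < c by rewrite exprn_gt0 // invr_gt0.
have d0 : 0 < d by rewrite exprn_gt0 // invr_gt0.
have PMc : \prod_i M i i <= c := le_trans AM.1 TM.
have dMle : \det M <= c := le_trans hadM.1 PMc.
(* Now [c * d <= \det M * H] while [\det M <= c] and [H <= d]: both bounds are attained, and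
   equality passes back through Hadamard and both uses of AM-GM. *)
have dMc : \det M = c.
  apply/le_anti; rewrite dMle -(ler_pM2r d0) (le_trans kB) //.
  by rewrite ler_pM2l // AE.1.
have Hd : H = d by apply/le_anti; rewrite AE.1 -(ler_pM2l c0) -{2}dMc.
have Er i : E i = r.+1%:R^-1.
  have /eq_mean-> : [forall i, forall j, E i == E j] by rewrite -AE.2 Hd.
  by rewrite E1 mul1r.
have hr i : h i 0 = r.+1%:R^-1 by rewrite -(Er (lift ord0 i)) /E liftK.
have h0r : h0 = r.+1%:R^-1 by rewrite -(Er ord0) /E unlift_none.
have PME : \prod_i M i i = c by apply/le_anti; rewrite PMc -{1}dMc hadM.1.
have TE : ((\sum_i M i i) / r%:R) ^+ r = c.
  by apply/le_anti; rewrite TM -{1}PME AM.1.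
have TE1 : (\sum_i M i i) / r%:R = r%:R^-1.
  apply/eqP; rewrite -(eqrXn2 r0) ?divr_ge0 ?invr_ge0 ?(ltW r0R) //.
  exact/eqP.
have Mr i : M i i = r%:R^-1.
  by rewrite -TE1; apply: (@eq_mean _ _ (fun k => M k k)); rewrite -AM.2 PME TE.
have ME : M = r%:R^-1%:M.
  have /is_diag_mxP Mdiag : is_diag_mx M by rewrite -hadM.2 dMc PME.
  apply/matrixP => i j; rewrite [RHS]mxE.
  by have [->|ij] := eqVneq i j; [rewrite Mr|rewrite Mdiag].
split; first by apply/matrixP => i j; rewrite ord1 hr mxE.
have KE : K = r.+1%:R%:M + const_mx r.+1%:R.
  rewrite /K h0r invrK; congr (_ + _); apply/matrixP => i j.
  by rewrite !mxE hr invrK.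
have KG : K *m mvie_gram R r = r%:R^-1%:M.
  rewrite KE mulmx_scalar_const [X in const_mx X](_ : _ = 0).
    rewrite [const_mx 0]raddf0 addr0; congr (_%:M); field.
    by rewrite r10 gt_eqF.
  by field; rewrite r10 gt_eqF.
(* A one-sided inverse of a square matrix is two-sided, which moves the right factor [B] of [M] to
   the front. *)
have BK : B *m B^T *m K = r%:R^-1%:M.
  have rB : (r%:R *: (B^T *m K)) *m B = 1%:M.
    by rewrite -scalemxAl -/M ME scale_scalar_mx mulfV // gt_eqF.
  have /(congr1 (fun X => r%:R^-1 *: X)) := mulmx1C rB.
  rewrite -scalemxAr scalerA mulVf ?gt_eqF // scale1r scale_scalar_mx mulr1.
  by rewrite mulmxA.
(* Both [B *m B^T] and [mvie_gram] are inverses of [r K], hence equal. *)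
have : r%:R *: (B *m B^T *m K *m mvie_gram R r) = mvie_gram R r.
  by rewrite BK mul_scalar_mx scalerA mulfV ?gt_eqF // scale1r.
rewrite -mulmxA KG mul_mx_scalar scalerA mulfV ?gt_eqF // scale1r => -> //.
Qed.

(** [is_MVIE] compares with positive semidefinite matrices, so a competitor of that kind is built:
    the positive square root of [mvie_gram], with eigenvalue [a * p] on the all-ones vector and [a]
    on its orthogonal complement. *)
Lemma mvie_attained (R : realType) r : (0 < r)%N ->
  exists C : 'M[R]_r, [/\ psd C, Defs.subset (ellipsoid C (mvie_center R r)) (@B1plus R r),
    0 <= \det C & \det C ^+ 2 = mvie_det2 R r].
Proof.
move=> r0; have r0R : 0 < r%:R :> R by rewrite ltr0n.
have r1R : 0 < r.+1%:R :> R by rewrite ltr0n.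
have r10 : 1 + r%:R != 0 :> R by rewrite addrC natr1 gt_eqF.
pose a : R := (Num.sqrt (r%:R * r.+1%:R))^-1.
pose p : R := (Num.sqrt r.+1%:R)^-1.
have a2 : a ^+ 2 = (r%:R * r.+1%:R)^-1.
  by rewrite exprVn sqr_sqrtr // mulr_ge0 // ltW.
have p2 : p ^+ 2 = r.+1%:R^-1 by rewrite exprVn sqr_sqrtr // ltW.
have a0 : 0 < a by rewrite invr_gt0 sqrtr_gt0 mulr_gt0.
have p0 : 0 < p by rewrite invr_gt0 sqrtr_gt0.
clearbody a p.
pose b := - (a * ((1 - p) / r%:R)).
pose C : 'M[R]_r := a%:M + const_mx b.
have sumc x : \sum_(i < r) x = r%:R * x :> R.
  by rewrite sumr_const card_ord -[LHS]mulr_natl.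
have detC : \det C = a ^+ r * p.
  rewrite /C -diag_const_mx det_diag_add_const => [|i]; last by rewrite mxE gt_eqF.
  rewrite (eq_bigr (fun=> a)) => [|i _]; last by rewrite mxE.
  rewrite prodr_const card_ord (eq_bigr (fun=> a^-1)) => [|i _]; last by rewrite mxE.
  by rewrite sumc /b; congr (_ * _); field; rewrite !gt_eqF.
have CC : C *m C^T = mvie_gram R r.
  rewrite /C trmx_scalar_const mulmx_scalar_const -expr2 a2; congr (_ + const_mx _).
  rewrite -a2 -p2 /b [LHS](_ : _ = - a ^+ 2 / r%:R * (1 - p ^+ 2)).
    by rewrite p2 -[r.+1%:R]nat1r; field; rewrite r10 gt_eqF.
  by field; rewrite gt_eqF.
exists C; split.
- split=> [|u]; first exact: trmx_scalar_const.
  rewrite dotv_scalar_const; set s := \sum_i _.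
  (* Subtracting the mean of [u] yields [s ^+ 2 / r%:R <= dotv u u], which compensates the negative
     [b]. *)
  have := dotvv_ge0 (u - const_mx (s / r%:R)).
  rewrite dotvDl !dotvDr !dotvNl !dotvNr (dotvC u) !dotv_const -/s.
  under eq_bigr do rewrite mxE.
  rewrite sumc (_ : dotv u u + _ + _ = dotv u u - s ^+ 2 / r%:R); last first.
    by field; rewrite gt_eqF.
  rewrite subr_ge0 -(ler_pM2l a0) => us.
  have : 0 <= a * (p * (s ^+ 2 / r%:R)).
    by rewrite (mulr_ge0 (ltW a0)) // (mulr_ge0 (ltW p0)) // divr_ge0 ?sqr_ge0 // ltW.
  have -> : b * s ^+ 2 = a * (p * (s ^+ 2 / r%:R)) - a * (s ^+ 2 / r%:R).
    by rewrite /b; field; rewrite gt_eqF.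
  lra.
- apply/ellipsoid_sub_B1plusP; rewrite CC.
  have hs : 1 - \sum_i mvie_center R r i 0 = r.+1%:R^-1.
    under eq_bigr do rewrite mxE.
    by rewrite sumc -nat1r; field; rewrite r10.
  split=> [i|].
    rewrite !mxE eqxx mulr1n invr_ge0 (ltW r1R); split=> //.
    by rewrite -nat1r le_eqVlt; apply/orP; left; apply/eqP; field; rewrite r10 gt_eqF.
  rewrite hs invr_ge0 (ltW r1R); split=> //; rewrite dotv_scalar_const dotv_const.
  under eq_bigr do rewrite mxE.
  rewrite sumc -nat1r le_eqVlt; apply/orP; left; apply/eqP.
  by field; rewrite r10 gt_eqF.
- by rewrite detC mulr_ge0 ?exprn_ge0 // ltW.
rewrite detC exprMn -exprM mulnC exprM a2 p2 /mvie_det2 exprS invfM exprMn.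
by rewrite -mulrA; congr (_ * _); rewrite mulrC.
Qed.

(** Maximality against the ellipsoid of [mvie_attained] gives the determinant bound, and
    [mvie_unique] the rest. *)
Lemma MVIE_B1plus (R : realType) r (C : 'M[R]_r) g : (0 < r)%N ->
  is_MVIE (@B1plus R r) C g ->
  [/\ g = mvie_center R r, C *m C^T = mvie_gram R r & mvie_det2 R r <= \det C ^+ 2].
Proof.
move=> r0 [_ [sub maxC]]; have [C' [psdC' sub' dC'0 dC']] := mvie_attained R r0.
have dC : mvie_det2 R r <= \det C ^+ 2.
  have le := maxC _ _ psdC' sub'.
  by rewrite -dC' lerXn2r // nnegrE // (le_trans dC'0).
by have [-> ->] := mvie_unique r0 sub dC.
Qed.

Lemma mvie_det2_gt0 (R : realType) r : (0 < r)%N -> 0 < mvie_det2 R r.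
Proof. by move=> r0; rewrite mulr_gt0 // exprn_gt0 // invr_gt0 ltr0n. Qed.

(** * Polar sets and their extreme points *)

Lemma dotv_suml (R : realType) r n (P : pred 'I_n) (q : 'I_n -> 'cV[R]_r) (y : 'cV[R]_r) :
  dotv (\sum_(k | P k) q k) y = \sum_(k | P k) dotv (q k) y.
Proof.
apply: (big_morph (fun z => dotv z y)); last exact: dotv0l.
by move=> u v; rewrite dotvDl.
Qed.

Lemma polar_ellipsoidP (R : realType) r (C : 'M[R]_r) g x :
  polar (ellipsoid C g) g x <-> dotv (C^T *m x) (C^T *m x) <= 1.
Proof.
transitivity (forall u, dotv u u <= 1 -> dotv (C^T *m x) u <= 1).
  split=> [px u u1|px y [u [u1 ->]]].
    by have := px (C *m u + g); rewrite addrK dotv_mulmx; apply; exists u.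
  by rewrite addrK dotv_mulmx; apply: px.
by rewrite dotv_le_ballP expr1n; split=> [[]|] //; split.
Qed.

(** The point [x] lies in the polar, and every dilation of it by a factor above 1 leaves the
    polar. *)
Lemma boundary_polar_ellipsoid (R : realType) r (C : 'M[R]_r) g x :
  dotv (C^T *m x) (C^T *m x) = 1 -> boundary (polar (ellipsoid C g) g) x.
Proof.
move=> x1 e e0; split.
  exists x; rewrite subrr dotv0r exprn_gt0 //; split=> //.
  by apply/polar_ellipsoidP; rewrite x1.
have s0 := dotvv_ge0 x; set s := dotv x x in s0.
(* With this [t] the displacement satisfies [t ^+ 2 * s < (t * (1 + s)) ^+ 2 = e ^+ 2]. *)
pose t := e / (1 + s); have t0 : 0 < t by rewrite divr_gt0 // ltr_pwDl.
have te : t * (1 + s) = e by rewrite divfK // gt_eqF // ltr_pwDl.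
exists ((1 + t) *: x); split; last first.
  move=> /polar_ellipsoidP; rewrite -scalemxAr dotvZl dotvZr x1; nra.
rewrite scalerDl scale1r addrC addKr dotvZl dotvZr -/s -te; nra.
Qed.

(** Split off an index [j] of nonzero weight. If weight remains, the renormalised remainder lies in
    the polar by convexity, and extremality makes it coincide with [q j]. *)
Lemma extreme_polar_conv (R : realType) r (A : vset R r) (d : 'cV[R]_r)
    n (q : 'I_n -> 'cV[R]_r) (lam : 'I_n -> R) x :
  (forall j, polar A d (q j)) -> (forall j, 0 <= lam j) -> \sum_j lam j = 1 ->
  x = \sum_j lam j *: q j -> extreme (polar A d) x -> exists j, x = q j.
Proof.
move=> pq lam0 lam1 xE [_ ext].
have /existsP[j lj] : [exists j, lam j != 0].
  apply: contraT; rewrite negb_exists => /forallP l0.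
  move: lam1; rewrite big1 => [/eqP|k _]; first by rewrite eq_sym oner_eq0.
  by apply/eqP; have := l0 k; rewrite negbK.
exists j; move: lam1 xE; rewrite (bigD1 j) //= [in X in _ -> X -> _](bigD1 j) //=.
set l := \sum_(k < n | _) lam k => lam1 xE.
have l0 : 0 <= l by apply: sumr_ge0.
have [l00|ln0] := eqVneq l 0.
  have lk k : k != j -> lam k = 0.
    by move=> kj; apply: (psumr_eq0P _ l00).
  rewrite xE big1 => [|k /lk->]; last by rewrite scale0r.
  by rewrite addr0; have -> : lam j = 1; [lra|rewrite scale1r].
have lp : 0 < l by rewrite lt0r ln0.
have ljp : 0 < lam j by rewrite lt0r lj lam0.
pose z := l^-1 *: \sum_(k < n | k != j) lam k *: q k.
have lz : (1 - lam j) *: z = \sum_(k < n | k != j) lam k *: q k.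
  have -> : 1 - lam j = l by lra.
  by rewrite scalerA mulfV // scale1r.
have qz : q j = z.
  apply: (ext (q j) z (lam j)) => //; [|lra|by rewrite lz].
  move=> y Ay; rewrite dotvZl dotv_suml -(ler_pM2l lp) mulrA mulfV // mul1r mulr1.
  by apply: ler_sum => k _; rewrite dotvZl ler_piMr // pq.
by rewrite xE -lz -qz -scalerDl addrC subrK scale1r.
Qed.

Lemma sum_mvie_center (R : realType) r :
  \sum_i mvie_center R r i 0 = r%:R / r.+1%:R.
Proof.
under eq_bigr do rewrite mxE.
by rewrite sumr_const card_ord -[LHS]mulr_natl.
Qed.

(** The vertex of the polar dual to the facet [y i 0 = 0]: its pairing with [y] minus the center is
    [1 - r.+1%:R * y i 0]. *)
Lemma polar_B1plus_delta (R : realType) r (i : 'I_r) :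
  polar (@B1plus R r) (mvie_center R r) (- r.+1%:R *: delta_mx i 0).
Proof.
move=> y [/(_ i) yi _]; rewrite dotvZl dotv_delta !mxE mulNr mulrBr.
by rewrite mulfV ?pnatr_eq0 // opprB gerBl mulr_ge0.
Qed.

Lemma polar_B1plus_const (R : realType) r :
  polar (@B1plus R r) (mvie_center R r) (const_mx r.+1%:R).
Proof.
move=> y [_ ys]; rewrite dotvDr dotvNr !dotv_const sum_mvie_center.
rewrite mulrCA mulfV ?pnatr_eq0 // mulr1 lerBlDr nat1r.
by rewrite ler_piMr.
Qed.

(* The polar of the simplex is the simplex spanned by the vectors [q k]; the
   weights [lam k] are the barycentric coordinates of [x] in it. *)
Lemma extreme_polar_B1plus (R : realType) r (x : 'cV[R]_r) :
  extreme (polar (@B1plus R r) (mvie_center R r)) x ->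
  (exists i, x = - r.+1%:R *: delta_mx i 0) \/ x = const_mx r.+1%:R.
Proof.
move=> ext; have [px _] := ext.
have r1 : 0 < r.+1%:R :> R by rewrite ltr0n.
pose s := \sum_i x i 0 / r.+1%:R.
have xc : dotv x (mvie_center R r) = s.
  by apply: eq_bigr => i _; rewrite mxE.
(* Testing [x] on the vertices [0] and [delta_mx i 0] of the simplex gives the signs of the
   weights. *)
have s1 : 0 <= 1 + s.
  have : B1plus (0 : 'cV[R]_r).
    by split=> [i|]; rewrite ?mxE // big1 ?ler01 // => i _; rewrite mxE.
  by move=> /px; rewrite sub0r dotvNr xc; lra.
have xs i : 0 <= 1 + s - x i 0.
  have : B1plus (delta_mx i 0 : 'cV[R]_r).
    split=> [j|]; first by rewrite mxE ler0n.
    rewrite -(mul1r (\sum_j _)) -dotv_const dotvC dotv_delta mxE //.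
  by move=> /px; rewrite dotvDr dotvNr xc dotvC dotv_delta; lra.
pose q (k : 'I_r.+1) : 'cV[R]_r :=
  if unlift ord0 k is Some i then - r.+1%:R *: delta_mx i 0 else const_mx r.+1%:R.
pose lam (k : 'I_r.+1) :=
  (if unlift ord0 k is Some i then 1 + s - x i 0 else 1 + s) / r.+1%:R.
have : exists k, x = q k.
  apply: (@extreme_polar_conv R r (@B1plus R r) (mvie_center R r) _ q lam) => //.
  - move=> k; rewrite /q; case: unlift => [i|].
      exact: polar_B1plus_delta.
    exact: polar_B1plus_const.
  - by move=> k; rewrite /lam divr_ge0 ?(ltW r1) //; case: unlift.
  - rewrite big_ord_recl /lam unlift_none.
    under eq_bigr do rewrite liftK mulrBl.
    rewrite sumrB sumr_const card_ord -/s -[_ *+ r]mulr_natl.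
    by rewrite -nat1r; field; rewrite addrC natr1 pnatr_eq0.
  - rewrite big_ord_recl /lam /q unlift_none.
    under eq_bigr do rewrite liftK scalerA mulrN divfK ?gt_eqF //.
    apply/matrixP => i j; rewrite ord1 !mxE summxE divfK ?gt_eqF //.
    rewrite (bigD1 i) //= big1 => [|k /negPf ki]; last first.
      by rewrite !mxE eq_sym ki mulr0.
    by rewrite !mxE !eqxx mulr1; ring.
move=> [k ->]; rewrite /q; case: unlift => [i|]; [left; by exists i|by right].
Qed.

(** * Convex hulls of columns and recovery of the permutation *)

Lemma B1plus_conv_cols (R : realType) r N (S : 'M[R]_(r, N)) y :
  (forall j, B1plus (col j S)) -> conv_cols S y -> B1plus y.
Proof.
move=> SP [lam [lam0 [lam1 ->]]]; split=> [i|].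
  rewrite mxE; apply: sumr_ge0 => j _; rewrite mulr_ge0 //.
  by have [/(_ i)] := SP j; rewrite mxE.
under eq_bigr do rewrite mxE.
rewrite exchange_big /= -lam1; apply: ler_sum => j _.
rewrite -mulr_suml ler_piMl //; have [_] := SP j.
by under eq_bigr do rewrite mxE.
Qed.

(** A row vector annihilating [S] vanishes on the hull of its columns, hence on the ellipsoid: it
    kills first [g], then every column of the invertible [C]. *)
Lemma row_free_conv_cols (R : realType) r N (S : 'M[R]_(r, N)) (C : 'M[R]_r) g :
  C \in unitmx -> Defs.subset (ellipsoid C g) (conv_cols S) -> row_free S.
Proof.
move=> uC sub; rewrite -kermx_eq0; apply/rowV0P => v /sub_kermxP vS.
have vE u : dotv u u <= 1 -> v *m (C *m u + g) = 0.
  move=> u1; have [|lam [_ [_ ->]]] := sub (C *m u + g); first by exists u.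
  by rewrite mulmxA vS mul0mx.
have vg : v *m g = 0 by have := vE 0; rewrite dotv0l mulmx0 add0r; apply; exact: ler01.
suff vC : v *m C = 0 by rewrite -(mulmxK uC v) vC mul0mx.
apply/rowP => i; rewrite -[v *m C]mulmx1.
have := vE (delta_mx i 0); rewrite dotv_delta mxE !eqxx mulmxDr vg addr0 mulmxA.
move=> /(_ (lexx _))/matrixP/(_ 0 0); rewrite -colE mxE => vCi.
by rewrite mulmx1 vCi !mxE.
Qed.

Lemma gram_det_gt0 (R : realType) m n (S : 'M[R]_(m, n)) :
  row_free S -> 0 < \det (S *m S^T).
Proof.
move=> fS; suff /hadamard_posdef[] : posdef (S *m S^T) by [].
split=> [|u u0]; first by rewrite trmx_mul trmxK.
rewrite -mulmxA dotv_mulmx dotvv_gt0; apply: contraNneq u0 => Su.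
rewrite -[u]trmxK -trmx0; apply/eqP; congr (_^T).
by apply: (row_free_inj fS); rewrite mul0mx -[LHS]trmxK trmx_mul trmxK Su trmx0.
Qed.

(** Invertibility makes the rows distinct, so the map from a row to the position of its 1 is
    injective, hence a permutation. *)
Lemma perm_mx_of_rows (R : realType) r (A : 'M[R]_r) :
  A \in unitmx -> (forall i, exists j, A^T *m delta_mx i 0 = delta_mx j 0 :> 'cV_r) ->
  exists s : 'S_r, A = perm_mx s.
Proof.
move=> uA rA; have /fin_all_exists[f fE] := rA.
have fI : injective f.
  move=> i k fik; have : A^T *m delta_mx i 0 = A^T *m delta_mx k 0 :> 'cV_r.
    by rewrite !fE fik.
  rewrite -unitmx_tr in uA; move=> /(can_inj (mulKmx uA))/matrixP/(_ i 0)/eqP.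
  by rewrite !mxE !eqxx !andbT eqr_nat; have [|] := eqVneq i k.
exists (perm fI); apply/matrixP => i j.
have /matrixP/(_ j 0) := fE i; rewrite -colE !mxE eqxx andbT permE => ->.
by rewrite eq_sym.
Qed.

Theorem theorem5 (R : realType) (r M N : nat) (hr : (0 < r)%N)
  (hrM : (r <= M)%N) (hrN : (r <= N)%N)
  (Hg : 'M[R]_(M, r)) (Sg : 'M[R]_(r, N))
  (hHg : \rank Hg = r)
  (hSg : forall j : 'I_N, B1plus (col j Sg))
  (hscat : suff_scattered (B1plus (R:=R) (r:=r)) Sg) :
  forall (Hs : 'M[R]_(M, r)) (Ss : 'M[R]_(r, N)),
    detmax_opt (Hg *m Sg) (B1plus (R:=R) (r:=r)) Hs Ss ->
    exists s : 'S_r, Hs = Hg *m (perm_mx s)^T /\ Ss = perm_mx s *m Sg.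
Proof.
move: hscat => [C [g [mvie [[_ subE] polarE]]]] Hs Ss [[YE SsP] opt].
have [gE CC dC] := MVIE_B1plus hr mvie; rewrite {}gE in mvie subE polarE.
have k0 := mvie_det2_gt0 R hr.
have uC : C \in unitmx.
  by rewrite unitmxE unitfE -sqrf_eq0 gt_eqF // (lt_le_trans k0).
have fSg := row_free_conv_cols uC subE.
have /row_fullP[Hi HiHg] : row_full Hg by rewrite /row_full hHg.
pose D := Hi *m Hs.
have SgE : Sg = D *m Ss by rewrite -mulmxA -YE mulmxA HiHg mul1mx.
have uD : D \in unitmx.
  rewrite -row_full_unit /row_full eqn_leq rank_leq_col.
  by rewrite -{1}(eqP fSg) SgE mxrankM_maxl.
pose A := invmx D.
have uA : A \in unitmx by rewrite unitmx_inv.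
have SsE : Ss = A *m Sg by rewrite SgE mulKmx.
have HsE : Hs *m A = Hg.
  by apply: (row_free_inj fSg); rewrite -mulmxA -SsE YE.
(* The pair [Hg], [Sg] is feasible, and [\det (Ss *m Ss^T) = \det A ^+ 2 * \det (Sg *m Sg^T)]. *)
have dA : 1 <= \det A ^+ 2.
  rewrite -(ler_pM2r (gram_det_gt0 fSg)) mul1r (le_trans (opt Hg Sg _)) //.
  by rewrite SsE trmx_mul mulmxA -[A *m Sg *m _]mulmxA !det_mulmx det_tr mulrAC.
have subA : Defs.subset (ellipsoid (A *m C) (A *m mvie_center R r)) (@B1plus R r).
  move=> x [u [u1 ->]]; rewrite -mulmxA -mulmxDr.
  have [|lam [lam0 [lam1 ->]]] := subE (C *m u + mvie_center R r); first by exists u.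
  by rewrite mulmxA -SsE; apply: (B1plus_conv_cols SsP); exists lam.
have [|Ag AG] := mvie_unique hr subA.
  by rewrite det_mulmx exprMn (le_trans dC) // ler_peMl // sqr_ge0.
rewrite trmx_mul mulmxA -[A *m C *m _]mulmxA CC in AG.
have r10 : 1 + r%:R != 0 :> R by rewrite addrC natr1 pnatr_eq0.
have rn0 : r%:R != 0 :> R by rewrite pnatr_eq0 -lt0n.
have [s As] : exists s : 'S_r, A = perm_mx s.
  apply: perm_mx_of_rows => // i; pose q : 'cV[R]_r := - r.+1%:R *: delta_mx i 0.
  (* The maximal ellipsoid touches the facet dual to [q], so [q] is on the boundary of the polar
     ellipsoid. *)
  have q1 : dotv q (mvie_gram R r *m q) = 1.
    rewrite /q -scalemxAr dotvZl dotvZr -colE dotv_delta !mxE eqxx mulr1n.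
    by rewrite -nat1r; field; rewrite r10 rn0.
  have : extreme (polar (@B1plus R r) (mvie_center R r)) (A^T *m q).
    apply/polarE; split; last first.
      apply: boundary_polar_ellipsoid.
      by rewrite -dotv_mulmx mulmxA CC -dotv_mulmx 2!mulmxA AG.
    (* As [A] fixes the center, the pairing becomes that of [q] with a point of the hull of [Ss],
       inside the simplex. *)
    move=> y [lam [lam0 [lam1 ->]]]; rewrite -dotv_mulmx mulmxBr Ag mulmxA -SsE.
    by apply: polar_B1plus_delta; apply: (B1plus_conv_cols SsP); exists lam.
  move=> /extreme_polar_B1plus[[j]|].
    rewrite -scalemxAr => /scalerI Aj; exists j; apply: Aj.
    by rewrite oppr_eq0 pnatr_eq0.
  (* The remaining vertex [const_mx r.+1%:R] is excluded by pairing with the center: [-1] on one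
     side, [r] on the other. *)
  move=> /(congr1 (fun x => dotv x (mvie_center R r))).
  rewrite -dotv_mulmx Ag dotvZl dotv_delta dotv_const mxE.
  under eq_bigr do rewrite mxE.
  rewrite sumr_const card_ord -[_ *+ r]mulr_natl mulrCA mulNr.
  rewrite mulfV ?pnatr_eq0 // => r_eq; have : 0 <= r%:R :> R by rewrite ler0n.
  lra.
exists s; rewrite -As; split=> //.
by rewrite -HsE -mulmxA As tr_perm_mx -perm_mxM mulgV perm_mx1 mulmx1.
Qed.
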